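(* Let $(G_n,\delta_n)_{n\in\mathbb{N}}$ be a sequence of proper monoids, with $e_n$ the identity element of $G_n$, such that for all $n\in\mathbb{N}$ there exist $\varepsilon_n>0$ and $$(\varsigma_n,\varkappa_n)\in\mathrm{UIso}_{\varepsilon_n}\left((G_n,\delta_n)\to(G_{n+1},\delta_{n+1})\,\middle|\,\tfrac{1}{\varepsilon_n}\right)$$ such that: 1. $\sum_{n=0}^\infty\varepsilon_n<\infty$; 2. for all $N\in\mathbb{N}$ and $g\in G_N\left[\frac{1}{\sum_{n=N}^\infty\varepsilon_n}\right]$, the sequence $\varpi_N(g)=(g_n)_{n\in\mathbb{N}}$ defined by $g_n=e_n$ if $n<N$, $g_N=g$, and $g_n=\varsigma_{n-1}(g_{n-1})$ if $n>N$, belongs to $\mathcal{R}((G_n,\delta_n)_{n\in\mathbb{N}})$. Then there exists a proper monoid $(G,\delta)$ such that $\lim_{n\to\infty}\Upsilon((G_n,\delta_n),(G,\delta))=0$.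
   Context: A metric monoid $(G,\delta)$ is a monoid $G$ with a left invariant metric $\delta$ (that is, $\delta(gh,gk)=\delta(h,k)$ for all $g,h,k\in G$) for which the multiplication is (jointly) continuous. It is proper (a ''proper monoid'') when all its closed balls are compact. For $r\ge 0$, $G[r]$ is the closed ball of radius $r$ centered at the identity element of $G$. Let $(G_1,\delta_1)$, $(G_2,\delta_2)$ be metric monoids with identity elements $e_1,e_2$, and let $\varepsilon\ge0$, $r\ge0$. $\mathrm{UIso}_{\varepsilon}((G_1,\delta_1)\to(G_2,\delta_2)\,|\,r)$ is the set of all ordered pairs $(\varsigma_1,\varsigma_2)$ of maps (not assumed continuous or multiplicative) $\varsigma_1:G_1\to G_2$, $\varsigma_2:G_2\to G_1$ such that for all $\{j,k\}=\{1,2\}$: $\varsigma_j(e_j)=e_k$, and for all $g,g'\in G_j[r]$ and $h\in G_k[r]$, $|\delta_k(\varsigma_j(g)\varsigma_j(g'),h)-\delta_j(gg',\varsigma_k(h))|\le\varepsilon$. The Gromov-Hausdorff monoid distance between proper metric monoids is $$\Upsilon((G_1,\delta_1),(G_2,\delta_2))=\min\left\{\tfrac{\sqrt2}{2},\inf\left\{\varepsilon>0:\mathrm{UIso}_\varepsilon\left((G_1,\delta_1)\to(G_2,\delta_2)\,\middle|\,\tfrac1\varepsilon\right)\neq\emptyset\right\}\right\}.$$ For a sequence $(G_n,\delta_n)_{n\in\mathbb{N}}$ of proper monoids, $\prod_{n\in\mathbb{N}}G_n$ denotes the set of bounded sequences: those $(g_n)_{n\in\mathbb{N}}$ with $g_n\in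 G_n$ for which there is $M>0$ with $g_n\in G_n[M]$ for all $n$. The set of regular sequences $\mathcal{R}((G_n,\delta_n)_{n\in\mathbb{N}})$ is the set of all $(g_n)_{n\in\mathbb{N}}\in\prod_{n\in\mathbb{N}}G_n$ such that for every $\varepsilon>0$ there exist $\omega>0$ and $N\in\mathbb{N}$ such that for all $n\ge N$ and all $h,k\in G_n$: $\delta_n(h,k)<\omega\implies\delta_n(hg_n,kg_n)<\varepsilon$. *)

(* Defs.v *)
From HB Require Import structures.
From mathcomp Require Import all_boot all_order all_algebra.
From mathcomp Require Import all_classical all_reals all_analysis.
From mathcomp Require Import lra.

Set Implicit Arguments.
Unset Strict Implicit.
Unset Printing Implicit Defensive.

Import Order.TTheory GRing.Theory Num.Theory.
Import numFieldNormedType.Exports.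

Local Open Scope classical_set_scope.
Local Open Scope ring_scope.

HB.mixin Record MetricMonoid_axioms (R : realType) G
    of Metric R G & Monoid G := {
  mdistMl : forall g h k : G, mdist (g * h)%g (g * k)%g = mdist h k ;
  mulg_continuous : continuous (fun x : G * G => (x.1 * x.2)%g)
}.

#[short(type="metricMonoidType")]
HB.structure Definition MetricMonoid (R : realType) :=
  { G of Metric R G & Monoid G & MetricMonoid_axioms R G }.

(* The library's [closed_ball] is the closure of an open ball, which in a
   metric space can be strictly smaller than the closed ball meant here. *)
HB.mixin Record MetricMonoid_isProper (R : realType) G
    of MetricMonoid R G := {
  compact_closed_balls :
    forall (x : G) (r : R), compact [set y : G | mdist x y <= r]
}.

#[short(type="properMonoidType")]
HB.structure Definition ProperMonoid (R : realType) :=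
  { G of MetricMonoid R G & MetricMonoid_isProper R G }.

Definition cball_id (R : realType) (G : metricMonoidType R) (r : R) : set G :=
  [set g | mdist 1%g g <= r].
Arguments cball_id {R} G r.

(* The conditions on (s1, s2) for a fixed (j, k), here (j, k) = (1, 2). *)
Definition half_UIso (R : realType) (G1 G2 : metricMonoidType R) (e r : R)
    (s1 : G1 -> G2) (s2 : G2 -> G1) : Prop :=
  s1 1%g = 1%g /\
  forall (g g' : G1) (h : G2),
    cball_id G1 r g -> cball_id G1 r g' -> cball_id G2 r h ->
    `| mdist (s1 g * s1 g')%g h - mdist (g * g')%g (s2 h) | <= e.

Definition UIso (R : realType) (G1 G2 : metricMonoidType R) (e r : R) :
    set ((G1 -> G2) * (G2 -> G1)) :=
  [set s | half_UIso e r s.1 s.2 /\ half_UIso e r s.2 s.1].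
Arguments UIso {R} G1 G2 e r.

Definition UIso_radii (R : realType) (G1 G2 : metricMonoidType R) : set R :=
  [set e | 0 < e /\ UIso G1 G2 e e^-1 !=set0].

Definition Upsilon (R : realType) (G1 G2 : properMonoidType R) : R :=
  Num.min (Num.sqrt 2 / 2) (inf (UIso_radii G1 G2)).

(* [inf] is a genuine infimum in [Upsilon]: constant maps give 2. *)
Lemma has_inf_UIso_radii (R : realType) (G1 G2 : metricMonoidType R) :
  has_inf (UIso_radii G1 G2).
Proof.
split; last by exists 0 => e [/ltW].
have half (H1 H2 : metricMonoidType R) :
    @half_UIso R H1 H2 2 2^-1 (fun=> 1%g) (fun=> 1%g).
  split=> // g g' h; rewrite /cball_id /= mulg1 => g1 g'1 h1.
  have gg' : mdist (g * g')%g 1%g <= 2^-1 + 2^-1 :> R.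
    rewrite metric_sym (le_trans (metric_triangle _ g _))//.
    by rewrite lerD// -[X in mdist X _]mulg1 mdistMl.
  have d1 := mdist_ge0 (1%g : H2) h; have d2 := mdist_ge0 (g * g')%g (1%g : H1).
  by rewrite ler_norml; lra.
by exists 2; split=> //; exists (fun=> 1%g, fun=> 1%g); split; exact: half.
Qed.

Definition bounded_seq (R : realType) (G : nat -> metricMonoidType R) :
    set (forall n, G n) :=
  [set g | exists2 M : R, 0 < M & forall n, cball_id (G n) M (g n)].

Definition regular_seq (R : realType) (G : nat -> metricMonoidType R) :
    set (forall n, G n) :=
  [set g | bounded_seq g /\
    forall e : R, 0 < e -> exists w : R, 0 < w /\ exists N : nat,
      forall n, (N <= n)%N -> forall h k : G n,
        mdist h k < w -> mdist (h * g n)%g (k * g n)%g < e].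

(* [dfwith (fun=> 1) g] is g at index N and the identity elsewhere. *)
Fixpoint varpi (R : realType) (G : nat -> metricMonoidType R)
    (s : forall n, G n -> G n.+1) (N : nat) (g : G N) (n : nat) : G n :=
  match n return G n with
  | 0 => eqtype.dfwith (T := G) (fun=> 1%g) g 0%N
  | m.+1 => if (N <= m)%N then s m (varpi s g m)
            else eqtype.dfwith (T := G) (fun=> 1%g) g m.+1
  end.

Section varpi_equations.
Context (R : realType) (G : nat -> metricMonoidType R).
Context (s : forall n, G n -> G n.+1) (N : nat) (g : G N).

Lemma varpi_lt n : (n < N)%N -> varpi s g n = 1%g.
Proof.
case: n => [|n] nN /=; first by rewrite dfwith_out ?gtn_eqF.
by rewrite leqNgt (ltnW nN)/= dfwith_out ?gtn_eqF.
Qed.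

Lemma varpi_id : varpi s g N = g.
Proof. by move: g; case: N => [|M] x /=; rewrite ?ltnn dfwith_in. Qed.

Lemma varpi_gt n : (N <= n)%N -> varpi s g n.+1 = s (varpi s g n).
Proof. by move=> /= ->. Qed.

End varpi_equations.

(* Main.v *)
From HB Require Import structures.
Require Import Defs.
From mathcomp Require Import all_boot all_order all_algebra.
From mathcomp Require Import all_classical all_reals all_analysis.
From mathcomp Require Import lra.
Import Order.TTheory GRing.Theory Num.Theory.
Import numFieldNormedType.Exports.
Local Open Scope classical_set_scope.
Local Open Scope ring_scope.

Set Implicit Arguments.
Unset Strict Implicit.
Unset Printing Implicit Defensive.

(** Write [t n] for the sum of the [eps k] with [k >= n], and [S g m] for the entry at level [m] of
    the orbit [varpi sigma g] of [g : G n]. On balls of radius [r] with [(r + 1) * t n <= 1], the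
    errors of the connecting maps telescope: [g |-> S g m] is isometric and multiplicative up to
    [2 * (t n - t m)] ([varpi_isom], [varpi_mul]) and nearly onto ([varpi_surj]).

    The limit is made of coherent sequences: eventually bounded sequences [x] that asymptotically
    follow their own orbits, [S (x n) m] being close to [x m] for all [m >= n] once [n] is large.
    For two of them the distances [mdist (x n) (y n)] converge, which gives a left invariant
    pseudometric. Left invariance says nothing about right multiplication; this is where regularity
    enters. It passes from orbits to coherent sequences ([coherent_regular]), makes them stable
    under pointwise product ([coherentM]) and makes the product continuous. Identifying sequences at
    distance zero yields a metric monoid [H] ([metric_monoid_quotient], [limit_metric_monoid]).

    Sending [g : G n] to the class of its orbit is, on balls, isometric, multiplicative and onto up
    to a constant times [t n]. Closed balls of [H] are compact ([limit_compact]): an ultrafilter on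
    a ball is pulled back to each [G n], where it clusters at some [x n]; the sequence [x] is
    coherent and its class is the limit. For large [n], the map to [H] and an approximate section of
    it form the required pair ([UIso_radii_near]), thanks to uniform continuity of right
    multiplication on balls of [H] ([mulg_right_unif]). *)

(** * The metric monoid attached to a pseudometric one *)

Section pseudometric_quotient.
Context (R : realType) (T : Type) (d : T -> T -> R).
Context (m : T -> T -> T) (o : T).
Hypothesis dxx : forall x, d x x = 0.
Hypothesis dsym : forall x y, d x y = d y x.
Hypothesis dtri : forall y x z, d x z <= d x y + d y z.
Hypothesis dA : forall x y z, d (m x (m y z)) (m (m x y) z) = 0.
Hypothesis d1m : forall x, d (m o x) x = 0.
Hypothesis dm1 : forall x, d (m x o) x = 0.
Hypothesis dMl : forall x y z, d (m x y) (m x z) = d y z.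
Hypothesis dMr : forall y (e : R), 0 < e ->
  exists2 w : R, 0 < w & forall x z, d x z < w -> d (m x y) (m z y) <= e.

Let dge0 x y : 0 <= d x y.
Proof. by have := dtri y x x; rewrite dxx (dsym y x); lra. Qed.

Let dle0 x y : d x y <= 0 -> d x y = 0.
Proof. by move=> dxy; apply: le_anti; rewrite dxy dge0. Qed.

Let dcong x x' y y' : d x x' = 0 -> d y y' = 0 -> d x y = d x' y'.
Proof.
move=> xx yy; apply: le_anti.
have := dtri x' x y; have := dtri y' x' y; have := dtri x x' y'.
have := dtri y x y'; rewrite (dsym x' x) (dsym y' y); lra.
Qed.

(** Multiplication descends to classes: the right factor is moved by left invariance, the left one
    by [dMr] for every [e]. *)
Let dM0 x x' y y' : d x x' = 0 -> d y y' = 0 -> d (m x y) (m x' y') = 0.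
Proof.
move=> xx yy; apply: dle0; apply/ler_addgt0Pl => e e0; rewrite addr0.
have [w w0 /(_ x x')] := dMr y e0; rewrite xx => /(_ w0) xy.
by have := dtri (m x' y) (m x y) (m x' y'); rewrite dMl yy; lra.
Qed.

(** Classes are sets of points, so that their equality is extensional; distance and product are
    computed on chosen representatives. *)
Definition pquot : Type := {A : set T | exists x, A = [set y | d x y = 0]}.

Let cl x : pquot := exist _ [set y | d x y = 0] (ex_intro _ x erefl).

Let clE x y : d x y = 0 -> cl x = cl y.
Proof.
by move=> xy; apply: eq_exist; apply/seteqP; split=> z /= h;
  rewrite -h; apply: dcong => //; rewrite ?dxx// dsym.
Qed.

Let rep (A : pquot) : T := projT1 (cid (svalP A)).

Let repK A : cl (rep A) = A.
Proof.
by case: A => A hA; apply: eq_exist; rewrite /rep; case: cid => x /= ->.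
Qed.

Let clK x : d (rep (cl x)) x = 0.
Proof.
have /(congr1 (fun A : pquot => sval A x)) /= := repK (cl x).
by rewrite dxx => ->.
Qed.

HB.instance Definition _ := gen_eqMixin pquot.
HB.instance Definition _ := gen_choiceMixin pquot.

Let qd (A B : pquot) : R := d (rep A) (rep B).
Let qm (A B : pquot) : pquot := cl (m (rep A) (rep B)).

Let qdxx A : qd A A = 0. Proof. exact: dxx. Qed.
Let qd_eq0 A B : qd A B = 0 -> A = B.
Proof. by move=> AB; rewrite -(repK A) -(repK B); exact: clE. Qed.
Let qdC A B : qd A B = qd B A. Proof. exact: dsym. Qed.
Let qd_tri B A C : qd A C <= qd A B + qd B C. Proof. exact: dtri. Qed.

HB.instance Definition _ := isMetric.Build R pquot qdxx qd_eq0 qdC qd_tri.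

Let qmA : associative qm.
Proof.
move=> A B C; apply: clE.
have d0 := dA (rep A) (rep B) (rep C).
by rewrite -d0; apply: dcong; apply: dM0; rewrite ?dxx ?clK.
Qed.
Let q1m : left_id (cl o) qm.
Proof.
move=> A; rewrite -[RHS]repK; apply: clE; rewrite -(d1m (rep A)).
by apply: dcong; rewrite ?dxx//; apply: dM0; rewrite ?dxx ?clK.
Qed.
Let qm1 : right_id (cl o) qm.
Proof.
move=> A; rewrite -[RHS]repK; apply: clE; rewrite -(dm1 (rep A)).
by apply: dcong; rewrite ?dxx//; apply: dM0; rewrite ?dxx ?clK.
Qed.

HB.instance Definition _ := isMonoid.Build pquot qmA q1m qm1.

Let mdist_cl x y : mdist (cl x) (cl y) = d x y.
Proof. by apply: dcong; exact: clK. Qed.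

Let mulg_cl x y : (cl x * cl y)%g = cl (m x y).
Proof. by apply: clE; apply: dM0; exact: clK. Qed.

Let qdMl (A B C : pquot) : mdist (A * B)%g (A * C)%g = mdist B C.
Proof.
by rewrite -(repK A) -(repK B) -(repK C) !mulg_cl !mdist_cl dMl.
Qed.

(** Moving the left factor is controlled by [dMr] at the fixed right factor [B]; moving the right
    one is isometric. *)
Let qm_continuous : continuous (fun x : pquot * pquot => (x.1 * x.2)%g).
Proof.
move=> [A B]; apply/metricType_numDomainType.cvgrPdist_le => e e0 /=.
have e2 : 0 < e / 2 by rewrite divr_gt0.
have [w w0 hw] := dMr (rep B) e2.
have nA : \forall A' \near A, mdist A A' < w.
  by have := nbhsx_ballx A w w0; rewrite ballEmdist.
have nB : \forall B' \near B, mdist B B' < e / 2.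
  by have := nbhsx_ballx B _ e2; rewrite ballEmdist.
exists ([set A' | mdist A A' < w], [set B' | mdist B B' < e / 2]) => //=.
move=> [A' B'] /= [AA' BB'].
rewrite (le_trans (metric_triangle _ (A' * B)%g _))// qdMl.
rewrite [leRHS]splitr lerD//; last exact: ltW.
by rewrite -(repK A) -(repK A') -(repK B) !mulg_cl mdist_cl hw//.
Qed.

HB.instance Definition _ :=
  @MetricMonoid_axioms.Build R pquot qdMl qm_continuous.

Lemma metric_monoid_quotient : exists (H : metricMonoidType R) (c : T -> H),
  [/\ forall h, exists x, c x = h, c o = 1%g,
      forall x y, c (m x y) = (c x * c y)%g
    & forall x y, mdist (c x) (c y) = d x y].
Proof.
exists pquot, cl; by split=> // h; exists (rep h); rewrite repK.
Qed.

End pseudometric_quotient.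

(** * Proper monoids and a criterion for a small distance *)

(** An equality of structures, rather than an isometry, lets all facts about [H] hold verbatim for
    the proper monoid after substitution. *)
Lemma proper_of_compact (R : realType) (H : metricMonoidType R) :
  (forall (x : H) (r : R), compact [set y : H | mdist x y <= r]) ->
  exists K : properMonoidType R, (K : metricMonoidType R) = H.
Proof.
case: H => T c cH.
by exists (ProperMonoid.Pack
  (ProperMonoid.Class (MetricMonoid_isProper.Axioms_
    (MetricMonoid.Defs_MetricMonoid_axioms_mixin c) cH))).
Qed.

Lemma mdist1M (R : realType) (G : metricMonoidType R) (g h : G) :
  mdist 1%g (g * h)%g <= mdist 1%g g + mdist 1%g h.
Proof.
by rewrite (le_trans (metric_triangle _ g _))// lerD2l -{1}(mulg1 g) mdistMl.
Qed.

(** Joint continuity becomes uniform by compactness of a product of two balls; only [h] and [h']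
    range over the ball, [k] is any nearby point. *)
Lemma mulg_right_unif (R : realType) (H : properMonoidType R) (r e : R) :
  0 < e -> exists2 w : R, 0 < w & forall h k h' : H,
    mdist 1%g h <= r -> mdist 1%g h' <= r -> mdist h k < w ->
    mdist (h * h')%g (k * h')%g <= e.
Proof.
move=> e0; have e2 : 0 < e / 2 by rewrite divr_gt0.
have cB := compact_closed_balls (1%g : H) r.
have /compact_near_coveringP := compact_setX cB cB.
move=> /(_ R 0^'+ (fun w p => forall k, mdist p.1 k < w ->
   mdist (p.1 * p.2)%g (k * p.2)%g <= e) _) [].
  move=> [x y] _ /=.
  have /metricType_numDomainType.cvgrPdist_le /(_ _ e2) /= :=
    @mulg_continuous R H (x, y).
  case=> -[A B] /= [/nbhs_ballP[a /= a0 aA] nB] AB.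
  (* Radii are halved so that a point [k] within [w] of [h] is still in the ball of radius [a]
     around [x]. *)
  exists (ball x (a / 2) `*` B, [set w | w <= a / 2]) => /=.
    split; last by apply: nbhs_right_le; rewrite divr_gt0.
    exists (ball x (a / 2), B) => //=; split => //.
    by apply: nbhsx_ballx; rewrite divr_gt0.
  move=> [[h h'] w] /= [[xh yh'] wa] k hk.
  have hA : A h by apply: aA; apply: le_ball xh; rewrite ler_pdivrMr//; lra.
  have kA : A k.
    apply: aA; rewrite [a]splitr; apply: ball_triangle xh _.
    by rewrite ballEmdist /=; apply: lt_le_trans hk _.
  rewrite (le_trans (metric_triangle _ (x * y)%g _))//.
  rewrite [leRHS]splitr lerD//.
    by rewrite metric_sym; apply: (AB (h, h')).
  exact: (AB (k, h')).
move=> a /= a0 aP; exists (a / 2); first by rewrite divr_gt0.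
move=> h k h' hr h'r hk.
apply: (aP (a / 2) _ _ (h, h')) => //=; last by rewrite divr_gt0.
by rewrite /ball /= sub0r normrN gtr0_norm ?divr_gt0// ltr_pdivrMr//; lra.
Qed.

Lemma Upsilon_le (R : realType) (G H : properMonoidType R) (e : R) :
  UIso_radii G H e -> 0 <= Upsilon G H <= e.
Proof.
move=> Ge; have [_ lb] := has_inf_UIso_radii G H; apply/andP; split.
  rewrite le_min divr_ge0 ?sqrtr_ge0//=.
  by apply: lb_le_inf; [exists e | move=> x [/ltW]].
by rewrite ge_min (ge_inf lb)// orbT.
Qed.

                                                                            
                                                                          
                                                      
(** The pair is [f] with an approximate section [s]. The condition on [f] is a chain of triangle
    inequalities; the one on [s] also replaces [f (s h)] by [h] to the left of [h'], which needs
    uniform continuity of right multiplication in [H]. *)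
Lemma UIso_radii_near (R : realType) (H : properMonoidType R) (e : R) :
  0 < e -> exists r w : R, [/\ 0 <= r, 0 < w &
    forall (G : properMonoidType R) (f : G -> H), f 1%g = 1%g ->
    (forall g g', mdist 1%g g <= r -> mdist 1%g g' <= r ->
       `|mdist (f g) (f g') - mdist g g'| <= w) ->
    (forall g g', mdist 1%g g <= r -> mdist 1%g g' <= r ->
       mdist (f g * f g')%g (f (g * g')%g) <= w) ->
    (forall h, mdist 1%g h <= r -> exists2 g, mdist 1%g g <= mdist 1%g h + 1 &
       mdist (f g) h < w) ->
    UIso_radii G H e].
Proof.
move=> e0; have ei0 : 0 < e^-1 by rewrite invr_gt0.
have e4 : 0 < e / 4 by rewrite divr_gt0.
have [w0 w00 hw0] := mulg_right_unif H (e^-1 + 1) e4.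
(* [s] sends the ball of radius [e^-1] into that of radius [e^-1 + 1], and a product doubles the
   radius. The errors total [3 * w] for [f] and [3 * w + e / 4] for [s]. *)
exists (2 * (e^-1 + 1)), (Num.min w0 (e / 4)).
split; [lra | by rewrite lt_min w00 |] => G f f1 fd fm fs.
set r := 2 * _ in fd fm fs; have rE : r = 2 * (e^-1 + 1) by [].
set w := Num.min _ _ in fd fm fs.
have we4 : w <= e / 4 by rewrite ge_min lexx orbT.
have ww0 : w <= w0 by rewrite ge_min lexx.
have w_gt0 : 0 < w by rewrite lt_min w00.
have [s hs] : {s : H -> G | s 1%g = 1%g & forall h, mdist 1%g h <= r ->
    mdist 1%g (s h) <= mdist 1%g h + 1 /\ mdist (f (s h)) h < w}.
  (* The unit is treated apart because [UIso] requires [s 1 = 1] exactly; outside the ball of radius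
     [r] the value is a dummy. *)
  have /choice[s hs] : forall h : H, exists g : G, (h = 1%g -> g = 1%g) /\
      (mdist 1%g h <= r -> mdist 1%g g <= mdist 1%g h + 1 /\
                           mdist (f g) h < w).
    move=> h; have [->|h1] := eqVneq h 1%g.
      by exists 1%g; split=> // _; rewrite f1 !mdistxx; split=> //; lra.
    have [hr|hr] := pselect (mdist 1%g h <= r).
      have [g g1 gh] := fs h hr; exists g; split=> // /eqP.
      by rewrite (negPf h1).
    by exists 1%g.
  by apply: cid2; exists s => [|h]; [exact: (hs 1%g).1 | exact: (hs h).2].
move=> hs'.
split=> //; exists (f, s); split=> //=; split=> //; rewrite /cball_id /=.
  move=> g g' h g1 g'1 h1.
  have [|sh1 shd] := hs' h; first lra.
  have gg := mdist1M g g'.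
  have g1r : mdist 1%g g <= r by lra.
  have g'1r : mdist 1%g g' <= r by lra.
  have ggr : mdist 1%g (g * g')%g <= r by lra.
  have shr : mdist 1%g (s h) <= r by lra.
  have := fm g g' g1r g'1r.
  have := fd (g * g')%g (s h) ggr shr.
  have := metric_triangle (f g * f g')%g (f (g * g')%g) h.
  have := metric_triangle (f (g * g')%g) (f g * f g')%g h.
  have := metric_triangle (f (g * g')%g) (f (s h)) h.
  have := metric_triangle (f (g * g')%g) h (f (s h)).
  rewrite (metric_sym h (f (s h))) (metric_sym _ (f g * f g')%g).
  rewrite !ler_norml; move: we4; lra.
move=> h h' g h1 h'1 g1.
have [|sh1 shd] := hs' h; first lra.
have [|sh'1 sh'd] := hs' h'; first lra.
have ss := mdist1M (s h) (s h').
have g1r : mdist 1%g g <= r by lra.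
have shr : mdist 1%g (s h) <= r by lra.
have sh'r : mdist 1%g (s h') <= r by lra.
have ssr : mdist 1%g (s h * s h')%g <= r by lra.
have hh' : mdist (f (s h) * h')%g (h * h')%g <= e / 4.
  by rewrite metric_sym hw0//; [lra|lra|rewrite metric_sym; lra].
have a1 := fm (s h) (s h') shr sh'r.
have a2 := fd (s h * s h')%g g ssr g1r.
have a3 : mdist (f (s h) * f (s h'))%g (f (s h) * h')%g < w by rewrite mdistMl.
have a4 : mdist (f (s h * s h')%g) (h * h')%g <= 2 * w + e / 4.
  have := metric_triangle (f (s h * s h')%g) (f (s h) * f (s h'))%g (h * h')%g.
  have := metric_triangle (f (s h) * f (s h'))%g (f (s h) * h')%g (h * h')%g.
  by rewrite (metric_sym (f (s h * s h')%g) (f (s h) * _)%g); lra.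
have := metric_triangle (f (s h * s h')%g) (h * h')%g (f g).
have := metric_triangle (h * h')%g (f (s h * s h')%g) (f g).
rewrite (metric_sym (h * h')%g (f (s h * s h')%g)).
move: a2; rewrite !ler_norml; move: we4 a4; lra.
Qed.

(** * Tails of a convergent series *)

Section tail_sums.
Context (R : realType) (u : nat -> R).
Hypothesis cu : cvgn (series u).

Lemma tail_sumE n :
  \big[+%R/0]_(n <= k <oo) u k = limn (series u) - series u n.
Proof.
apply: cvg_lim => //.
apply: (@cvg_trans _ ((series u N - series u n) @[N --> \oo])).
  apply: near_eq_cvg; near=> N.
  by rewrite sub_series_geq//; near: N; exact: nbhs_infty_ge.
by apply: cvgB => //; exact: cvg_cst.
Unshelve. all: by end_near. Qed.

Lemma tail_sum_recl n :
  \big[+%R/0]_(n <= k <oo) u k = u n + \big[+%R/0]_(n.+1 <= k <oo) u k.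
Proof.
rewrite (tail_sumE n) (tail_sumE n.+1) -(seriesSB u n).
by move: (limn _) (series u n.+1) (series u n) => a b c; lra.
Qed.

Lemma tail_sum_cvg0 : \big[+%R/0]_(n <= k <oo) u k @[n --> \oo] --> (0 : R).
Proof.
rewrite (_ : (fun n => _) = fun n => limn (series u) - series u n); last first.
  by apply/funext => n; rewrite tail_sumE.
by rewrite -(subrr (limn (series u))); apply: cvgB => //; exact: cvg_cst.
Qed.

Lemma tail_sum_gt0 n :
  (forall k, 0 < u k) -> 0 < \big[+%R/0]_(n <= k <oo) u k.
Proof.
move=> u0; rewrite tail_sum_recl ltr_wpDr// tail_sumE subr_ge0.
apply: nondecreasing_cvgn_le => //; apply/nondecreasing_seqP => k.
by rewrite -subr_ge0 seriesSB ltW.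
Qed.

End tail_sums.

(** * Orbits and single approximate isometries *)

Lemma varpi_varpi (R : realType) (G : nat -> metricMonoidType R)
    (s : forall n, G n -> G n.+1) n (g : G n) m k :
  (n <= m)%N -> (m <= k)%N -> varpi s (varpi s g m) k = varpi s g k.
Proof.
move=> nm; elim: k => [|k IH] mk.
  by move: mk nm; rewrite leqn0 => /eqP ->; rewrite varpi_id.
move: mk; rewrite leq_eqVlt => /orP[/eqP <-|]; first by rewrite varpi_id.
rewrite ltnS => mk; rewrite !varpi_gt// ?IH//; exact: leq_trans mk.
Qed.

Section half_UIso_theory.
Context (R : realType) (G1 G2 : metricMonoidType R) (e r : R).
Context (s1 : G1 -> G2) (s2 : G2 -> G1).
Hypotheses (r0 : 0 <= r) (h12 : half_UIso e r s1 s2).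

Lemma half_UIso_dist g h : mdist 1%g g <= r -> mdist 1%g h <= r ->
  `|mdist (s1 g) h - mdist g (s2 h)| <= e.
Proof.
move=> gr hr; have [s11 /(_ g 1%g h gr _ hr)] := h12.
by rewrite s11 !mulg1; apply; rewrite /cball_id /= mdistxx.
Qed.

Lemma half_UIso_norm g : s2 1%g = 1%g -> mdist 1%g g <= r ->
  mdist 1%g (s1 g) <= mdist 1%g g + e.
Proof.
move=> s21 gr; have := half_UIso_dist gr (h := 1%g); rewrite s21 mdistxx.
by move=> /(_ r0); rewrite ler_norml !(metric_sym _ 1%g); lra.
Qed.

End half_UIso_theory.

(** * Error estimates along orbits *)

Section limit_monoid.
Context (R : realType) (G : nat -> properMonoidType R) (eps : nat -> R).
Context (sigma : forall n, G n -> G n.+1) (kappa : forall n, G n.+1 -> G n).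
Context (t : nat -> R).
Arguments sigma : clear implicits.
Arguments kappa : clear implicits.
Hypothesis eps_gt0 : forall n, 0 < eps n.
Hypothesis sigma_kappa : forall n,
  UIso (G n) (G n.+1) (eps n) (eps n)^-1 (sigma n, kappa n).
Hypothesis t_gt0 : forall n, 0 < t n.
Hypothesis tS : forall n, t n = eps n + t n.+1.
Hypothesis t_cvg0 : t n @[n --> \oo] --> (0 : R).
Hypothesis regular : forall (N : nat) (g : G N),
  mdist 1%g g <= (t N)^-1 -> regular_seq (varpi sigma g).

Local Notation S := (varpi sigma).

Let sk n : half_UIso (eps n) (eps n)^-1 (sigma n) (kappa n) :=
  (sigma_kappa n).1.
Let ks n : half_UIso (eps n) (eps n)^-1 (kappa n) (sigma n) :=
  (sigma_kappa n).2.

Let sigma1 n : sigma n 1%g = 1%g. Proof. by have [] := sk n. Qed.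
Let kappa1 n : kappa n 1%g = 1%g. Proof. by have [] := ks n. Qed.
Let ieps_ge0 n : 0 <= (eps n)^-1. Proof. by rewrite invr_ge0 ltW. Qed.

Lemma tail_anti n m : (n <= m)%N -> t m <= t n.
Proof.
elim: m => [|m IH]; first by rewrite leqn0 => /eqP ->.
rewrite leq_eqVlt => /orP[/eqP -> //|]; rewrite ltnS => /IH.
by have := tS m; have := eps_gt0 m; lra.
Qed.

Lemma eps_le_tail n m : (n <= m)%N -> eps m <= t n.
Proof. by move=> /tail_anti; have := tS m; have := t_gt0 m.+1; lra. Qed.

Lemma inv_tail_le n m : (n <= m)%N -> (t n)^-1 <= (eps m)^-1.
Proof. by move=> nm; rewrite lef_pV2 ?posrE//; exact: eps_le_tail. Qed.

                                                                                
                                                                            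
(** The safe radii at level [n]: norms grow by at most [t n] along an orbit, so an orbit starting in
    the ball of radius [r] stays within [(t n)^-1], hence within [(eps m)^-1] for every [m >= n],
    where the [UIso] estimates apply. *)
Definition adm (r : R) n := 0 <= r /\ (r + 1) * t n <= 1.

Lemma adm_tail_le1 r n : adm r n -> t n <= 1.
Proof. by move=> [r0]; have := t_gt0 n; nra. Qed.

Lemma adm_le r n : adm r n -> r + t n <= (t n)^-1.
Proof.
move=> a; have := adm_tail_le1 a; case: a => r0 a t1.
by apply: (@le_trans _ _ (r + 1)); [lra | rewrite -[leRHS]mul1r ler_pdivlMr].
Qed.

Lemma adm_ball r n : adm r n -> r <= (t n)^-1.
Proof. by move=> /adm_le; have := t_gt0 n; lra. Qed.

Lemma admW r r' n m : adm r n -> 0 <= r' <= r -> (n <= m)%N -> adm r' m.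
Proof.
move=> [r0 a] /andP[r'0 r'r] nm; split=> //.
by have := tail_anti nm; have := t_gt0 m; nra.
Qed.

Lemma tail_near (e : R) : 0 < e -> \forall n \near \oo, t n <= e.
Proof.
move=> e0; have /cvgrPdist_le /(_ _ e0)[N _ tN] := t_cvg0.
by exists N => // n /tN; rewrite /= sub0r normrN gtr0_norm.
Qed.

Lemma adm_near r : 0 <= r -> \forall n \near \oo, adm r n.
Proof.
move=> r0; have r1 : 0 < r + 1 by lra.
have [|N _ tN] := @tail_near (r + 1)^-1; first by rewrite invr_gt0.
exists N => // n /tN /=; rewrite -[X in _ <= X]mul1r ler_pdivlMr// mulrC.
by move=> ?; split.
Qed.

Lemma varpi1 n m : S (1%g : G n) m = 1%g.
Proof.
have [mn|nm] := ltnP m n.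
  by rewrite varpi_lt.
rewrite -(subnKC nm); elim: (m - n)%N => [|k IH].
  by rewrite addn0 varpi_id.
by rewrite addnS varpi_gt ?leq_addr// IH sigma1.
Qed.

Lemma varpi_norm n r (g : G n) m : adm r n -> mdist 1%g g <= r -> (n <= m)%N ->
  mdist 1%g (S g m) <= mdist 1%g g + (t n - t m).
Proof.
move=> a gr nm; rewrite -(subnKC nm); elim: (m - n)%N => [|k IH].
  by rewrite addn0 varpi_id; lra.
rewrite addnS varpi_gt ?leq_addr//.
have := half_UIso_norm (ieps_ge0 _) (sk (n + k)) (kappa1 _)
  (g := S g (n + k)%N).
have := inv_tail_le (leq_addr k n); have := adm_le a.
have := t_gt0 (n + k); move=> a1 a2 a3 /(_ ltac:(lra)).
by have := tS (n + k); lra.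
Qed.

Lemma varpi_ball n r (g : G n) m : adm r n -> mdist 1%g g <= r -> (n <= m)%N ->
  mdist 1%g (S g m) <= (eps m)^-1.
Proof.
move=> a gr nm; have := varpi_norm a gr nm.
by have := inv_tail_le nm; have := adm_le a; have := t_gt0 m; lra.
Qed.

Let sigmaK n (h : G n) : mdist 1%g h <= (eps n)^-1 ->
  mdist 1%g (sigma n h) <= (eps n)^-1 -> mdist (kappa n (sigma n h)) h <= eps n.
Proof.
move=> hr shr; have := half_UIso_dist (ieps_ge0 _) (ks n) shr hr.
by rewrite mdistxx subr0 ger0_norm// mdist_ge0.
Qed.

(** Each step costs [2 * eps p]: once for testing [sigma p] against the point [sigma p (S g' p)],
    once for [kappa p] only nearly inverting [sigma p]. *)
Lemma varpi_isom n r (g g' : G n) m : adm r n -> mdist 1%g g <= r ->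
  mdist 1%g g' <= r -> (n <= m)%N ->
  `|mdist (S g m) (S g' m) - mdist g g'| <= 2 * (t n - t m).
Proof.
move=> a gr g'r nm; rewrite -(subnKC nm); elim: (m - n)%N => [|k].
  by rewrite addn0 !varpi_id !subrr normr0 mulr0.
set p := (n + k)%N; have np : (n <= p)%N by rewrite leq_addr.
rewrite addnS -/p !varpi_gt//.
have sr := varpi_ball a gr np; have s'r := varpi_ball a g'r np.
have s'r1 : mdist 1%g (sigma p (S g' p)) <= (eps p)^-1.
  have := varpi_norm a g'r (leqW np); rewrite varpi_gt//.
  by have := inv_tail_le np; have := adm_le a; have := t_gt0 p.+1; lra.
have := half_UIso_dist (ieps_ge0 _) (sk p) sr s'r1.
have := sigmaK s'r s'r1; rewrite metric_sym.
have := metric_triangle (S g p) (S g' p) (kappa p (sigma p (S g' p))).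
have := metric_triangle (S g p) (kappa p (sigma p (S g' p))) (S g' p).
rewrite (metric_sym (kappa p _)) !ler_norml; have := tS p.
lra.
Qed.

(** The [UIso] inequality for a product of two points is tested against the image of [S (g * g') p],
    so no continuity of right multiplication is involved. The radius [2 * r] accommodates
    [g * g']. *)
Lemma varpi_mul n r (g g' : G n) m : adm (2 * r) n -> mdist 1%g g <= r ->
  mdist 1%g g' <= r -> (n <= m)%N ->
  mdist (S g m * S g' m)%g (S (g * g')%g m) <= 2 * (t n - t m).
Proof.
move=> a gr g'r nm; rewrite -(subnKC nm).
have r0 : 0 <= r by have := mdist_ge0 1%g g; lra.
have ar : adm r n by apply: admW a _ _ => //; lra.
have ggr : mdist 1%g (g * g')%g <= 2 * r by have := mdist1M g g'; lra.
elim: (m - n)%N => [|k].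
  by rewrite addn0 !varpi_id mdistxx !subrr mulr0.
set p := (n + k)%N; have np : (n <= p)%N by rewrite leq_addr.
rewrite addnS -/p !varpi_gt//.
have sr := varpi_ball ar gr np; have s'r := varpi_ball ar g'r np.
have ssr := varpi_ball a ggr np.
have ssr1 : mdist 1%g (sigma p (S (g * g')%g p)) <= (eps p)^-1.
  have := varpi_norm a ggr (leqW np); rewrite varpi_gt//.
  by have := inv_tail_le np; have := adm_le a; have := t_gt0 p.+1; lra.
have [_ /(_ _ _ _ sr s'r ssr1)] := sk p.
have := sigmaK ssr ssr1; rewrite metric_sym.
have := metric_triangle (S g p * S g' p)%g (S (g * g')%g p)
  (kappa p (sigma p (S (g * g')%g p))).
rewrite !ler_norml; have := tS p.
lra.
Qed.

(** The witness is [h] pulled back through the successive [kappa]; each step adds [eps] both to the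
    norm and to the error. *)
Lemma varpi_surj n r m (h : G m) : adm r n -> (n <= m)%N ->
  mdist 1%g h + (t n - t m) <= r ->
  exists2 g : G n, mdist 1%g g <= mdist 1%g h + (t n - t m) &
    mdist (S g m) h <= t n - t m.
Proof.
move=> a; elim: m h => [|m IH] h nm hr; last first.
  move: nm; rewrite leq_eqVlt => /orP[/eqP nm|].
    by subst n; exists h; rewrite ?varpi_id ?mdistxx; lra.
  rewrite ltnS => nm; have hr1 : mdist 1%g h <= (eps m)^-1.
    have := inv_tail_le nm; have := adm_le a; have := tail_anti (leqW nm).
    by have := t_gt0 n; lra.
  have k1 := half_UIso_norm (ieps_ge0 _) (ks m) (sigma1 m) hr1.
  have [|g g1 gh] := IH (kappa m h) nm; first by have := tS m; lra.
  exists g; first by have := tS m; lra.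
  have gr : mdist 1%g g <= r by have := tS m; lra.
  rewrite varpi_gt//.
  have := half_UIso_dist (ieps_ge0 _) (sk m) (varpi_ball a gr nm) hr1.
  by rewrite ler_norml; have := tS m; lra.
move: nm; rewrite leqn0 => /eqP n0; subst n.
by exists h; rewrite ?varpi_id ?mdistxx; lra.
Qed.

(** * Coherent sequences *)

Let near_geq (P : nat -> Prop) : (\forall n \near \oo, P n) ->
  \forall n \near \oo, forall m, (n <= m)%N -> P m.
Proof.
move=> [N _ NP]; exists N => // n /= Nn m nm.
by apply: NP; exact: leq_trans nm.
Qed.

(** A Cauchy condition relative to the connecting maps: these sequences represent the points of the
    completed direct limit of the [G n]. *)
Definition coherent : set (forall n, G n) := [set x |
  (exists M : R, \forall n \near \oo, mdist 1%g (x n) <= M) /\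
  forall e : R, 0 < e -> \forall n \near \oo, forall m, (n <= m)%N ->
    mdist (S (x n) m) (x m) <= e].

Lemma coherent_varpi n (g : G n) : mdist 1%g g <= (t n)^-1 -> coherent (S g).
Proof.
move=> gn; split.
  by have [[M _ gM] _] := regular gn; exists M; near=> k; exact: gM.
move=> e e0; near=> k => m km; rewrite varpi_varpi ?mdistxx ?ltW//.
by near: k; exact: nbhs_infty_ge.
Unshelve. all: by end_near. Qed.

Lemma coherent_bound x : coherent x ->
  exists2 M : R, 0 <= M & \forall n \near \oo, mdist 1%g (x n) <= M.
Proof.
move=> [[M xM] _]; exists M => //; near \oo => n.
by apply: (le_trans (mdist_ge0 1%g (x n))); near: n.
Unshelve. all: by end_near. Qed.

(** The orbit of a late term [x n] is regular and stays [e / 3]-close to [x]; by left invariance,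
    replacing one by the other costs [e / 3] at each end. *)
Lemma coherent_regular x (e : R) : coherent x -> 0 < e -> exists2 w : R, 0 < w &
  \forall n \near \oo, forall h k : G n, mdist h k < w ->
    mdist (h * x n)%g (k * x n)%g <= e.
Proof.
move=> cx e0; have [M M0 xM] := coherent_bound cx.
have e3 : 0 < e / 3 by rewrite divr_gt0.
near \oo => n.
have xn : mdist 1%g (x n) <= (t n)^-1.
  by apply: le_trans (adm_ball (r := M) _); near: n => //; exact: adm_near.
have [_ /(_ _ e3)[w [w0 [N wN]]]] := regular xn.
have xnm : forall m, (n <= m)%N -> mdist (S (x n) m) (x m) <= e / 3.
  by near: n; exact: cx.2.
exists w => //; near=> m => h k hk.
have := xnm m; have := wN m _ h k hk.
move=> /(_ ltac:(near: m; exact: nbhs_infty_ge)) a1.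
move=> /(_ ltac:(near: m; exact: nbhs_infty_ge)) a2.
have := metric_triangle (h * x m)%g (h * S (x n) m)%g (k * x m)%g.
have := metric_triangle (h * S (x n) m)%g (k * S (x n) m)%g (k * x m)%g.
by rewrite !mdistMl (metric_sym (x m)); move: a1 a2; lra.
Unshelve. all: by end_near. Qed.

Lemma coherent1 : coherent (fun=> 1%g).
Proof.
split; first by exists 0; near=> n; rewrite mdistxx.
by move=> e e0; near=> n => m nm; rewrite varpi1 mdistxx ltW.
Unshelve. all: by end_near. Qed.

(** [S (x n * y n) m] is compared with [S (x n) m * S (y n) m] by [varpi_mul]; then the right factor
    is moved by left invariance and the left one by the regularity of [y]. *)
Lemma coherentM x y : coherent x -> coherent y ->
  coherent (fun n => x n * y n)%g.
Proof.
move=> cx cy; have [M M0 xM] := coherent_bound cx.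
have [M' M'0 yM'] := coherent_bound cy; split.
  exists (M + M'); near=> n; rewrite (le_trans (mdist1M _ _))// lerD//.
    by near: n.
  by near: n.
move=> e e0; have e4 : 0 < e / 4 by rewrite divr_gt0.
have [w w0 yw] := coherent_regular cy e4.
have w2 : 0 < w / 2 by rewrite divr_gt0.
near=> n => m nm.
have a : adm (2 * (M + M')) n by near: n; apply: adm_near; lra.
have xn : mdist 1%g (x n) <= M by near: n.
have yn : mdist 1%g (y n) <= M' by near: n.
have tn : t n <= e / 4 by near: n; apply: tail_near.
have xnm : forall m, (n <= m)%N -> mdist (S (x n) m) (x m) <= w / 2.
  by near: n; exact: cx.2.
have ynm : forall m, (n <= m)%N -> mdist (S (y n) m) (y m) <= e / 4.
  by near: n; exact: cy.2.
have wm : forall m, (n <= m)%N -> forall h k : G m, mdist h k < w ->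
    mdist (h * y m)%g (k * y m)%g <= e / 4.
  by near: n; exact: near_geq.
have := varpi_mul a (g := x n) (g' := y n) ltac:(lra) ltac:(lra) nm.
have := wm m nm (S (x n) m) (x m) ltac:(have := xnm m nm; lra).
have := ynm m nm; rewrite -(mdistMl (S (x n) m)).
have := metric_triangle (S (x n * y n)%g m) (S (x n) m * S (y n) m)%g
  (x m * y m)%g.
have := metric_triangle (S (x n) m * S (y n) m)%g (S (x n) m * y m)%g
  (x m * y m)%g.
rewrite (metric_sym (S (x n * y n)%g m) (S (x n) m * _)%g).
by have := t_gt0 m; lra.
Unshelve. all: by end_near. Qed.

(** The distances form a Cauchy sequence: passing from level [n] to [m] costs [2 * t n] by
    [varpi_isom], plus the two coherence errors. *)
Lemma coherent_cvg_dist x y : coherent x -> coherent y ->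
  cvgn (fun n => mdist (x n) (y n)).
Proof.
move=> cx cy; have [M M0 xM] := coherent_bound cx.
have [M' M'0 yM'] := coherent_bound cy.
apply/cauchy_cvgP/cauchy_exP => e e0; have e5 : 0 < e / 5 by rewrite divr_gt0.
near \oo => n; exists (mdist (x n) (y n)).
suff: \forall m \near \oo, `|mdist (x n) (y n) - mdist (x m) (y m)| < e by [].
near=> m.
have nm : (n <= m)%N by near: m; exact: nbhs_infty_ge.
have a : adm (M + M') n by near: n; apply: adm_near; lra.
have xn : mdist 1%g (x n) <= M by near: n.
have yn : mdist 1%g (y n) <= M' by near: n.
have tn : t n <= e / 5 by near: n; apply: tail_near.
have xnm : forall m, (n <= m)%N -> mdist (S (x n) m) (x m) <= e / 5.
  by near: n; exact: cx.2.
have ynm : forall m, (n <= m)%N -> mdist (S (y n) m) (y m) <= e / 5.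
  by near: n; exact: cy.2.
have := varpi_isom a (g := x n) (g' := y n) ltac:(lra) ltac:(lra) nm.
have := xnm m nm; have := ynm m nm; have := t_gt0 m.
have := metric_triangle (S (x n) m) (x m) (S (y n) m).
have := metric_triangle (x m) (y m) (S (y n) m).
have := metric_triangle (x m) (S (x n) m) (y m).
have := metric_triangle (S (x n) m) (S (y n) m) (y m).
rewrite (metric_sym (x m) (S (x n) m)) (metric_sym (y m) (S (y n) m)).
rewrite !ler_norml ltr_norml; lra.
Unshelve. all: by end_near. Qed.

(** * The limit metric monoid *)

Let cseq : Type := {x | coherent x}.
Let cdist (x y : cseq) : R := limn (fun n => mdist (sval x n) (sval y n)).
Let cmul (x y : cseq) : cseq := exist _ _ (coherentM (svalP x) (svalP y)).
Let cone : cseq := exist _ _ coherent1.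

Let cdist_cvg (x y : cseq) :
  mdist (sval x n) (sval y n) @[n --> \oo] --> cdist x y.
Proof. exact: coherent_cvg_dist (svalP x) (svalP y). Qed.

Arguments cdist_cvg : clear implicits.

Let cdist_ext (x y x' y' : cseq) :
  (forall n, mdist (sval x n) (sval y n) = mdist (sval x' n) (sval y' n)) ->
  cdist x y = cdist x' y'.
Proof. by move=> /funext xy; rewrite /cdist xy. Qed.

Let cdist0 (x y : cseq) : (forall n, sval x n = sval y n) -> cdist x y = 0.
Proof.
move=> xy; rewrite (cdist_ext (x' := x) (y' := x)) => [|n]; last by rewrite xy.
rewrite /cdist (_ : (fun n => _) = fun=> 0) ?lim_cst//.
by apply/funext => n; rewrite mdistxx.
Qed.

Lemma limit_metric_monoid :
  exists (H : metricMonoidType R) (cl : (forall n, G n) -> H),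
  [/\ forall h, exists2 x, coherent x & cl x = h, cl (fun=> 1%g) = 1%g,
      forall x y, coherent x -> coherent y ->
        cl (fun n => x n * y n)%g = (cl x * cl y)%g
    & forall x y, coherent x -> coherent y ->
        mdist (x n) (y n) @[n --> \oo] --> mdist (cl x) (cl y)].
Proof.
have [||||||||H [c [c_surj c1 cM cd]]] :=
  @metric_monoid_quotient R cseq cdist cmul cone.
- by move=> x; exact: cdist0.
- by move=> x y; apply: cdist_ext => n; exact: metric_sym.
- move=> y x z; have cD := cvgD (cdist_cvg x y) (cdist_cvg y z).
  apply: (ler_cvg_to (cdist_cvg x z) (cD _)).
  by near=> n; exact: metric_triangle.
- by move=> x y z; apply: cdist0 => n; exact: mulgA.
- by move=> x; apply: cdist0 => n; exact: mul1g.
- by move=> x; apply: cdist0 => n; exact: mulg1.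
- by move=> x y z; apply: cdist_ext => n; exact: mdistMl.
(* A strict bound on the limit distance holds at all late levels, where the regularity of [y]
   applies, and the resulting bound passes to the limit. *)
- move=> y e e0; have [w w0 yw] := coherent_regular (svalP y) e0.
  exists w => // x z xz; apply: limr_le.
    by apply: cvgP; exact: (cdist_cvg (cmul x y) (cmul z y)).
  near=> n; apply: (near yw n) => //.
  by near: n; apply: cvgr_lt xz; exact: cdist_cvg.
(* The class map is extended by a dummy value to all sequences, to avoid carrying coherence proofs
   in terms. *)
pose cl x := if pselect (coherent x) is left cx then c (exist _ x cx) else 1%g.
have clE x (cx : coherent x) : cl x = c (exist _ x cx).
  rewrite /cl; case: pselect => // cx'; congr c; exact: eq_exist.
exists H, cl; split.
- move=> h; have [[x cx] <-] := c_surj h; exists x => //; exact: clE.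
- by rewrite (clE _ coherent1).
- move=> x y cx cy.
  rewrite (clE _ cx) (clE _ cy) (clE _ (coherentM cx cy)) -cM.
  by congr c; exact: eq_exist.
- move=> x y cx cy; rewrite (clE _ cx) (clE _ cy) cd.
  exact: (cdist_cvg (exist _ x cx) (exist _ y cy)).
Unshelve. all: by end_near. Qed.

(** * The maps from each level to the limit, and compactness *)

Section limit_properties.
Context (H : metricMonoidType R) (cl : (forall n, G n) -> H).
Hypothesis cl_surj : forall h, exists2 x, coherent x & cl x = h.
Hypothesis cl1 : cl (fun=> 1%g) = 1%g.
Hypothesis clM : forall x y, coherent x -> coherent y ->
  cl (fun n => x n * y n)%g = (cl x * cl y)%g.
Hypothesis cl_dist : forall x y, coherent x -> coherent y ->
  mdist (x n) (y n) @[n --> \oo] --> mdist (cl x) (cl y).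

Let f n (g : G n) : H := cl (varpi sigma g).

Let cl_le x y (e : R) : coherent x -> coherent y ->
  (\forall n \near \oo, mdist (x n) (y n) <= e) -> mdist (cl x) (cl y) <= e.
Proof.
by move=> cx cy xy; apply: ler_cvg_to (cl_dist cx cy) (cvg_cst e) xy.
Qed.

Let cl_ge x y (e : R) : coherent x -> coherent y ->
  (\forall n \near \oo, e <= mdist (x n) (y n)) -> e <= mdist (cl x) (cl y).
Proof.
by move=> cx cy xy; apply: ler_cvg_to (cvg_cst e) (cl_dist cx cy) xy.
Qed.

Let coherent_f n r (g : G n) :
  adm r n -> mdist 1%g g <= r -> coherent (varpi sigma g).
Proof.
by move=> a gr; apply: coherent_varpi; apply: le_trans gr (adm_ball a).
Qed.

Lemma limit_map1 n : f (1%g : G n) = 1%g.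
Proof.
rewrite -cl1 /f; congr cl.
by apply: functional_extensionality_dep => m; exact: varpi1.
Qed.

Lemma limit_map_isom n r (g g' : G n) : adm r n -> mdist 1%g g <= r ->
  mdist 1%g g' <= r -> `|mdist (f g) (f g') - mdist g g'| <= 2 * t n.
Proof.
move=> a gr g'r; have cg := coherent_f a gr; have cg' := coherent_f a g'r.
have lb : mdist g g' - 2 * t n <= mdist (f g) (f g').
  apply: cl_ge => //; near=> m.
  have nm : (n <= m)%N by near: m; exact: nbhs_infty_ge.
  have := varpi_isom a gr g'r nm.
  by rewrite ler_norml; have := t_gt0 m; lra.
have ub : mdist (f g) (f g') <= mdist g g' + 2 * t n.
  apply: cl_le => //; near=> m.
  have nm : (n <= m)%N by near: m; exact: nbhs_infty_ge.
  have := varpi_isom a gr g'r nm.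
  by rewrite ler_norml; have := t_gt0 m; lra.
by rewrite ler_norml; lra.
Unshelve. all: by end_near. Qed.

Lemma limit_map_mul n r (g g' : G n) : adm (2 * r) n -> mdist 1%g g <= r ->
  mdist 1%g g' <= r -> mdist (f g * f g')%g (f (g * g')%g) <= 2 * t n.
Proof.
move=> a gr g'r; have r0 : 0 <= r by have := mdist_ge0 1%g g; lra.
have ar : adm r n by apply: admW a _ _ => //; lra.
have cg := coherent_f ar gr; have cg' := coherent_f ar g'r.
have cgg : coherent (varpi sigma (g * g')%g).
  by apply: coherent_f a _; have := mdist1M g g'; lra.
rewrite /f -clM//; apply: cl_le => //; first exact: coherentM.
near=> m.
have nm : (n <= m)%N by near: m; exact: nbhs_infty_ge.
have := varpi_mul a gr g'r nm.
by have := t_gt0 m; lra.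
Unshelve. all: by end_near. Qed.

Lemma limit_map_cvg x (e : R) : coherent x -> 0 < e ->
  \forall n \near \oo, mdist (f (x n)) (cl x) <= e.
Proof.
move=> cx e0; have [M M0 xM] := coherent_bound cx.
near=> n; have cn : coherent (varpi sigma (x n)).
  apply: (@coherent_f n M); last by near: n.
  by near: n; exact: adm_near.
apply: cl_le => //.
have xn : forall m, (n <= m)%N -> mdist (S (x n) m) (x m) <= e.
  by near: n; exact: cx.2.
by near=> m; apply: xn; near: m; exact: nbhs_infty_ge.
Unshelve. all: by end_near. Qed.

(** A late term [x m] of a representative of [h] is pulled back to level [n] by [varpi_surj]. The
    margin [3] covers the norm of the point found, at most [mdist 1 h + 2], and its growth up to
    level [m]. *)
Lemma limit_map_surj n (h : H) : adm (mdist 1%g h + 3) n ->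
  exists2 g : G n, mdist 1%g g <= mdist 1%g h + 2 * t n &
    mdist (f g) h <= 4 * t n.
Proof.
move=> a; have [x cx xh] := cl_surj h; have tn0 := t_gt0 n.
have tn1 := adm_tail_le1 a; have h0 := mdist_ge0 1%g h.
have x1 := cl_dist coherent1 cx; rewrite xh cl1 in x1.
near \oo => m; have nm : (n <= m)%N by near: m; exact: nbhs_infty_ge.
have xm : mdist 1%g (x m) <= mdist 1%g h + t n.
  by near: m; apply: cvgr_le x1 _ _; lra.
have xmk : forall k, (m <= k)%N -> mdist (S (x m) k) (x k) <= t n.
  by near: m; exact: cx.2.
have tm := tail_anti nm; have tm0 := t_gt0 m.
have [|g g1 gx] := @varpi_surj n _ m (x m) a nm; first lra.
have gr : mdist 1%g g <= mdist 1%g h + 2 by lra.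
have a2 : adm (mdist 1%g h + 2) n by apply: admW a _ _ => //; lra.
have am : adm (mdist 1%g h + 3) m by apply: admW a _ _ => //; lra.
exists g; first lra.
rewrite -xh; apply: cl_le => //; first exact: coherent_f a2 gr.
near=> k; have mk : (m <= k)%N by near: k; exact: nbhs_infty_ge.
have sgm := varpi_norm a2 gr nm.
have := varpi_isom am (g := S g m) (g' := x m) ltac:(lra) ltac:(lra) mk.
rewrite varpi_varpi// ler_norml; have := xmk k mk; have := t_gt0 k.
by have := metric_triangle (S g k) (S (x m) k) (x k); lra.
Unshelve. all: by end_near. Qed.

(** The class of the orbit of [x n] is also that of [S (x n) m], and level [m] embeds in [H] up to
    [2 * t m]; so closeness in [H] gives closeness in [G m]. This is how completeness of [H] is
    used. *)
Lemma coherent_of_cauchy x (M : R) :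
  (\forall n \near \oo, mdist 1%g (x n) <= M) ->
  (forall e : R, 0 < e -> \forall n \near \oo, forall m, (n <= m)%N ->
     mdist (f (x n)) (f (x m)) <= e) -> coherent x.
Proof.
move=> xM xC; split; first by exists M.
have M0 : 0 <= M.
  by near \oo => n; apply: (le_trans (mdist_ge0 1%g (x n))); near: n.
move=> e e0; have e2 : 0 < e / 2 by rewrite divr_gt0.
have e4 : 0 < e / 4 by rewrite divr_gt0.
near=> n => m nm.
have xn : forall m, (n <= m)%N -> mdist 1%g (x m) <= M.
  by near: n; exact: near_geq.
have a : adm (M + 1) n by near: n; apply: adm_near; lra.
have tn : t n <= e / 4 by near: n; exact: tail_near.
have aM : adm M n by apply: admW a _ _ => //; lra.
have am : adm (M + 1) m by apply: admW a _ _ => //; lra.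
have tm := tail_anti nm; have tm0 := t_gt0 m.
have sxn := varpi_norm aM (xn n (leqnn n)) nm.
have xnn := xn n (leqnn n); have xmm := xn m nm.
have tn1 := adm_tail_le1 a.
have : mdist (f (x n)) (f (x m)) <= e / 2.
  by have : forall m, (n <= m)%N -> mdist (f (x n)) (f (x m)) <= e / 2;
    [near: n; exact: xC | exact].
have : mdist (S (x n) m) (x m) - 2 * t m <= mdist (f (x n)) (f (x m)).
  apply: cl_ge; [exact: coherent_f aM xnn | apply: coherent_f am _; lra | ].
  near=> k; have mk : (m <= k)%N by near: k; exact: nbhs_infty_ge.
  have := varpi_isom am (g := S (x n) m) (g' := x m) ltac:(lra) ltac:(lra) mk.
  by rewrite varpi_varpi// ler_norml; have := t_gt0 k; lra.
lra.
Unshelve. all: by end_near. Qed.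

(** [U] is pushed to a compact ball of [G n] by an approximate section [s] and clusters at some [g].
    The error is [3 * t n] from [f g] to [f (s y)] and [4 * t n] from there to [y]. *)
Let cball_approx n (x0 : H) (r : R) (U : set_system H) :
  UltraFilter U -> U [set y | mdist x0 y <= r] ->
  adm (mdist 1%g x0 + r + 3) n ->
  exists2 g : G n, mdist 1%g g <= mdist 1%g x0 + r + 2 &
    \forall y \near U, mdist (f g) y <= 7 * t n.
Proof.
move=> UU UB a; set b := mdist 1%g x0 + r in a *.
have tn0 := t_gt0 n; have tn1 := adm_tail_le1 a.
have norm_le y : mdist x0 y <= r -> mdist 1%g y <= b.
  by have := metric_triangle 1%g x0 y; rewrite /b; lra.
have /choice[s hs] : forall y : H, exists g : G n, mdist x0 y <= r ->
    mdist 1%g g <= b + 2 /\ mdist (f g) y <= 4 * t n.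
  move=> y; have [yr|yr] := pselect (mdist x0 y <= r); last by exists 1%g.
  have yb := norm_le _ yr; have y0 := mdist_ge0 1%g y.
  have [|g g1 gy] := @limit_map_surj n y.
    by apply: admW a _ _ => //; lra.
  by exists g => _; split=> //; lra.
have Us : U [set y | mdist 1%g (s y) <= b + 2].
  by apply: filterS UB => y yr; have [] := hs y yr.
have [g [/= gb gU]] := compact_closed_balls (1%g : G n) (b + 2) (s @ U) _ Us.
exists g => //.
have Ug : \forall y \near U, mdist g (s y) < t n.
  (* For an ultrafilter, clustering at [g] already gives closeness: otherwise the complement would
     belong to [U] and miss a neighbourhood of [g]. *)
  have [//|Ug] := in_ultra_setVsetC [set y | mdist g (s y) < t n] UU.
  have ng : nbhs g [set g' | mdist g g' < t n].
    by have := nbhsx_ballx g _ tn0; rewrite ballEmdist.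
  have [g' [/= ]] := gU [set g' | ~ mdist g g' < t n] _ Ug ng.
  by [].
apply: filterS2 UB Ug => y /= yr gsy; have [sb sy] := hs y yr.
have y0 := mdist_ge0 1%g y; have yb := norm_le _ yr.
have a2 : adm (b + 2) n by apply: admW a _ _ => //; lra.
have := limit_map_isom a2 gb sb; rewrite ler_norml.
by have := metric_triangle (f g) (f (s y)) y; lra.
Qed.

Lemma limit_compact (x0 : H) (r : R) : compact [set y : H | mdist x0 y <= r].
Proof.
rewrite compact_ultra => U UU UB; set b := mdist 1%g x0 + r.
have b0 : 0 <= b.
  have [y /= yr] := filter_ex UB; have := mdist_ge0 1%g y.
  by have := metric_triangle 1%g x0 y; rewrite /b; lra.
have ex n : exists g : G n, adm (b + 3) n -> mdist 1%g g <= b + 2 /\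
    \forall y \near U, mdist (f g) y <= 7 * t n.
  have [a|na] := pselect (adm (b + 3) n); last by exists 1%g.
  by have [g gb gU] := cball_approx UU UB a; exists g.
pose x n : G n := projT1 (cid (ex n)).
have hx n : adm (b + 3) n -> mdist 1%g (x n) <= b + 2 /\
    \forall y \near U, mdist (f (x n)) y <= 7 * t n.
  exact: projT2 (cid (ex n)).
have anear : \forall n \near \oo, adm (b + 3) n by apply: adm_near; lra.
have cx : coherent x.
  apply: (@coherent_of_cauchy _ (b + 2)).
    by apply: filterS anear => n /hx[].
  (* Two members of [U] meet, so [f (x n)] and [f (x m)] have a common point within [7 * t n] and
     [7 * t m]. *)
  move=> e e0; have e14 : 0 < e / 14 by rewrite divr_gt0.
  near=> n => m nm.
  have an : adm (b + 3) n by near: n.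
  have am : adm (b + 3) m by apply: admW an _ _ => //; lra.
  have tn : t n <= e / 14 by near: n; exact: tail_near.
  have [_ xn] := hx n an; have [_ xm] := hx m am.
  have [y [/= yn ym]] := filter_ex (filterI xn xm).
  have := metric_triangle (f (x n)) y (f (x m)); rewrite (metric_sym y).
  by have := tail_anti nm; lra.
have Ucl (e : R) : 0 < e -> \forall y \near U, mdist (cl x) y < e.
  move=> e0; have e3 : 0 < e / 3 by rewrite divr_gt0.
  have e21 : 0 < e / 21 by rewrite divr_gt0.
  near \oo => n.
  have an : adm (b + 3) n by near: n.
  have tn : t n <= e / 21 by near: n; exact: tail_near.
  have fx : mdist (f (x n)) (cl x) <= e / 3 by near: n; exact: limit_map_cvg.
  have [_ xn] := hx n an; apply: filterS xn => y /= yn.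
  have := metric_triangle (cl x) (f (x n)) y; rewrite (metric_sym (cl x) (f _)).
  lra.
exists (cl x); split; last by apply/metricType_numDomainType.fcvgrPdist_lt.
apply/ler_addgt0Pl => e e0.
have [y [/= yr ye]] := filter_ex (filterI UB (Ucl e e0)).
have := metric_triangle x0 y (cl x); rewrite (metric_sym y).
lra.
Unshelve. all: by end_near. Qed.

End limit_properties.

(** * Convergence to the limit monoid *)

Lemma exists_limit :
  exists H : properMonoidType R, Upsilon (G n) H @[n --> \oo] --> (0 : R).
Proof.
have [H0 [cl [cl_surj cl1 clM cl_dist]]] := limit_metric_monoid.
have [H HE] := proper_of_compact (limit_compact cl_surj cl1 cl_dist).
subst H0; exists H; apply/cvgrPdist_le => e e0.
have [r [w [r0 w0 rw]]] := UIso_radii_near H e0.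
have w8 : 0 < w / 8 by rewrite divr_gt0.
near=> n.
have tn : t n <= w / 8 by near: n; exact: tail_near.
have a2r : adm (2 * r) n by near: n; apply: adm_near; lra.
have ar3 : adm (r + 3) n by near: n; apply: adm_near; lra.
have ar : adm r n by apply: admW a2r _ _ => //; lra.
have tn0 := t_gt0 n.
have /andP[U0 Ue] : 0 <= Upsilon (G n) H <= e.
  apply: Upsilon_le; apply: (rw _ (fun g => cl (varpi sigma g))).
  - exact: limit_map1 cl1 n.
  - move=> g g' gr g'r.
    by have := limit_map_isom cl_dist ar gr g'r; lra.
  - move=> g g' gr g'r.
    by have := limit_map_mul clM cl_dist a2r gr g'r; lra.
  - move=> h hr; have h0 := mdist_ge0 1%g h.
    have ah : adm (mdist 1%g h + 3) n by apply: admW ar3 _ _ => //; lra.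
    have [g g1 gh] := limit_map_surj cl_surj cl1 cl_dist ah.
    (* This says [2 * t n <= 1], which turns the norm increase in [limit_map_surj] into the allowed
       [1]. *)
    have a1 : adm 1 n by apply: admW ar3 _ _ => //; lra.
    by exists g; first (case: a1; lra); lra.
by rewrite sub0r normrN ger0_norm.
Unshelve. all: by end_near. Qed.

End limit_monoid.

Theorem theorem3p4 (R : realType) (G : nat -> properMonoidType R)
  (eps : nat -> R)
  (sigma : forall n, G n -> G n.+1) (kappa : forall n, G n.+1 -> G n)
  (eps_gt0 : forall n, 0 < eps n)
  (sigma_kappa : forall n,
     UIso (G n) (G n.+1) (eps n) (eps n)^-1 (sigma n, kappa n))
  (summable_eps : cvgn (series eps))
  (regular : forall (N : nat) (g : G N),
     cball_id (G N) (\big[+%R/0]_(N <= n <oo) eps n)^-1 g ->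
     regular_seq (varpi sigma g)) :
  exists H : properMonoidType R, Upsilon (G n) H @[n --> \oo] --> (0 : R).
Proof.
exact: (exists_limit eps_gt0 sigma_kappa
  (fun n => tail_sum_gt0 summable_eps n eps_gt0) (tail_sum_recl summable_eps)
  (tail_sum_cvg0 summable_eps) regular).
Qed.
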